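(* Let $\{H_i : i=1,\dots,n\}$ be a finite family of null hypotheses with $p$-values $P_1,\dots,P_n$, let $1\le k\le n$ be pre-specified, and let $\alpha\in(0,1)$. For each $I\subset\{1,\dots,n\}$ with $|I|\ge k$ let $H_I=\bigcap_{j\in I}H_j$, let $P_{1:I}\le\cdots\le P_{|I|:I}$ be the ordered values of $P_i$, $i\in I$, and suppose that for each such $I$ there are critical values $\alpha_{k:I}\le\cdots\le\alpha_{|I|:I}$ such that the local test which rejects $H_I$ if and only if $P_{j:I}\le\alpha_{j:I}$ for at least one $j\in\{k,\dots,|I|\}$ is a level $\alpha$ test of $H_I$. Consider the (generalized) closed testing procedure which automatically rejects the $k-1$ most significant hypotheses $H_{(1)},\dots,H_{(k-1)}$ and which rejects any other hypothesis $H_i$ if and only if $H_I$ is rejected by its local test for all $I\subset\{1,\dots,n\}$ with $|I|\ge k$ satisfying $i\in I$ and $P_i\ge P_{k:I}$. Then this procedure controls the $k$-FWER at level $\alpha$.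
   Context: Setting: $\Omega$ is the set of all possible distributions of the data. Each $H_i$ is a null hypothesis about the distribution of the data (a subset of $\Omega$), and $H_I=\bigcap_{i\in I}H_i$ is true iff all $H_i$, $i\in I$, are true. The family satisfies the free combination condition: for any $I\subseteq\{1,\dots,n\}$ there is a distribution $P\in\Omega$ for which all $H_i$, $i\in I$, are true and all $H_i$, $i\notin I$, are false. The $p$-values $P_1,\dots,P_n$ are random variables such that, whenever $H_i$ is true, $P\{P_i\le u\}\le u$ for all $u\in(0,1)$; their joint dependence is arbitrary. The ordered $p$-values are $P_{(1)}\le\cdots\le P_{(n)}$ with associated hypotheses $H_{(1)},\dots,H_{(n)}$. Level $\alpha$ local test: the local test of $H_I$ with critical values $\alpha_{k:I},\dots,\alpha_{|I|:I}$ is level $\alpha$ if $P\big(\bigcup_{j=k}^{|I|}\{P_{j:I}\le\alpha_{j:I}\}\big)\le\alpha$ whenever $H_I$ is true. $k$-FWER: if $V$ denotes the number of true null hypotheses that are rejected, then $k\text{-FWER}=P\{V\ge k\}$. A procedure controls the $k$-FWER at level $\alpha$ if $k\text{-FWER}\le\alpha$ for every $P\in\Omega$. *)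

(* Defs.v *)
From HB Require Import structures.
From mathcomp Require Import all_boot all_order all_algebra all_fingroup.
From mathcomp Require Import all_classical all_reals all_analysis.

Set Implicit Arguments.
Unset Strict Implicit.
Unset Printing Implicit Defensive.

Import Order.TTheory GRing.Theory Num.Theory.

Local Open Scope classical_set_scope.
Local Open Scope ring_scope.

(* The sample space [T] carries the data; a distribution of the data is a
   [probability T R], and a null hypothesis is a set of distributions. *)

Section Hypotheses.
Context {d : measure_display} {T : measurableType d} {R : realType} {n : nat}.
Implicit Types (Omega : set (probability T R)) (P : probability T R).
Implicit Types (H : 'I_n -> set (probability T R)) (p : 'I_n -> {mfun T >-> R}).

Definition free_combination Omega H : Prop :=
  forall I : {set 'I_n}, exists2 P, Omega P & forall i, H i P <-> i \in I.

Definition valid_pvalues H p : Prop :=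
  forall i P, H i P -> forall u : R, 0 < u < 1 ->
    (P [set x | p i x <= u]%R <= u%:E)%E.

Definition inter_hyp H (I : {set 'I_n}) : set (probability T R) :=
  \bigcap_(i in [set` I]) H i.

Definition true_nulls H P : {set 'I_n} := finset (fun i => `[< H i P >]).

(* [rej x] is the set of (indices of) hypotheses rejected on the data [x];
   the k-FWER is P{V >= k}. *)
Definition num_false_rejections H P (rej : T -> {set 'I_n}) (x : T) : nat :=
  #|true_nulls H P :&: rej x|.

Definition kFWER H (k : nat) (rej : T -> {set 'I_n}) P : \bar R :=
  P [set x | (k <= num_false_rejections H P rej x)%N].

Definition controls_kFWER Omega H (k : nat) (alpha : R)
    (rej : T -> {set 'I_n}) : Prop :=
  forall P, Omega P -> (kFWER H k rej P <= alpha%:E)%E.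

End Hypotheses.

Section ClosedTesting.
Context {d : measure_display} {T : measurableType d} {R : realType} {n : nat}.
Implicit Types (p : 'I_n -> {mfun T >-> R}) (I : {set 'I_n}).

(* The order statistic P_{j:I}; [j] counts from 1, hence the [j.-1]. *)
Definition ordered_pvalue p I (j : nat) (x : T) : R :=
  nth 0 (sort <=%R [seq p i x | i <- enum I]) j.-1.

(* [c j] is the critical value alpha_{j:I}, only relevant for k <= j <= |I|. *)
Definition local_test p (k : nat) I (c : nat -> R) (x : T) : bool :=
  [exists j : 'I_#|I|.+1, (k <= j)%N && (ordered_pvalue p I j x <= c j)].

Definition level_local_test (Omega : set (probability T R))
    (H : 'I_n -> set (probability T R)) p (k : nat) (alpha : R) I
    (c : nat -> R) : Prop :=
  forall P, Omega P -> inter_hyp H I P ->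
    (P [set x | local_test p k I c x] <= alpha%:E)%E.

(* [ord x] sorts the p-values observed on [x]: H_(j) is the hypothesis of
   index [ord x j], with [j] counting from 0. Ties may be broken in any way,
   as long as the resulting ordering depends measurably on the data. *)
Definition pvalue_ordering p (ord : T -> 'S_n) : Prop :=
  (forall s : 'S_n, measurable (ord @^-1` [set s])) /\
  (forall (x : T) (a b : 'I_n), (a <= b)%N ->
     p (ord x a) x <= p (ord x b) x).

Definition auto_rejected (k : nat) (ord : T -> 'S_n) (x : T) (i : 'I_n) : bool :=
  [exists j : 'I_n, (j < k.-1)%N && (ord x j == i)].

Definition closed_testing p (k : nat) (crit : {set 'I_n} -> nat -> R)
    (ord : T -> 'S_n) (x : T) : {set 'I_n} :=
  finset (fun i => auto_rejected k ord x i ||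
    [forall I : {set 'I_n},
      [&& (k <= #|I|)%N, i \in I & ordered_pvalue p I k x <= p i x] ==>
      local_test p k I (crit I) x]).

End ClosedTesting.

(* Main.v *)
Require Import Defs.
From HB Require Import structures.
From mathcomp Require Import all_boot all_order all_algebra all_fingroup.
From mathcomp Require Import all_classical all_reals all_analysis.

(** The argument is pointwise in the data.  Let [I] be the set of true nulls
    under [P].  If fewer than [k] hypotheses are true, [k] false rejections
    cannot happen.  Otherwise suppose that at least [k] true nulls are rejected
    on the data [x], and look at the least significant one among them, say [i]
    (the last in the ordering of the p-values).  At least [k - 1] hypotheses
    precede [i] in that ordering, so [i] is not among the automatically
    rejected ones; and at least [k] members of [I] have a p-value at most that
    of [i], so [P_i >= P_{k:I}].  Hence [i] can only have been rejected because
    the local test of [H_I] itself rejects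
    ([false_rejections_local_test]).  So [{V >= k}] is contained in the
    rejection event of the local test of the true hypothesis [H_I], which has
    probability at most [alpha].

    Passing from the inclusion of events to the inequality of probabilities
    takes the measurability of both events.  It rests on
    [ordered_pvalue_leE], which replaces a bound on an order statistic by a
    count of p-values, so that every event in sight is a finite Boolean
    combination of comparisons of p-values and of values of the ordering. *)

Set Implicit Arguments.
Unset Strict Implicit.
Unset Printing Implicit Defensive.

Import Order.TTheory GRing.Theory Num.Theory.

Local Open Scope classical_set_scope.
Local Open Scope ring_scope.

(** * Order statistics *)

(** The count on the right involves no sorting, which makes it suited both to
    the measurability proofs and to finding a hypothesis whose p-value is at
    least [P_{k:I}]. *)
Lemma ordered_pvalue_leE (d : measure_display) (T : measurableType d)
    (R : realType) (n : nat) (p : 'I_n -> {mfun T >-> R}) (I : {set 'I_n})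
    (j : nat) (x : T) (c : R) :
  (0 < j <= #|I|)%N ->
  (ordered_pvalue p I j x <= c) =
    (j <= #|finset (fun l => (l \in I) && (p l x <= c)%R)|)%N.
Proof.
case/andP=> j0 jI; rewrite /ordered_pvalue.
set s := [seq p i x | i <- enum I].
have -> : #|finset (fun l => (l \in I) && (p l x <= c))| = count (<= c) s.
  rewrite count_map -sum1_count big_enum_cond -sum1_card.
  by apply: eq_bigl => l; rewrite inE.
rewrite -(count_sort <=%R).
have ss : sorted <=%R (sort <=%R s) by exact: sort_le_sorted.
have sz : size (sort <=%R s) = #|I| by rewrite size_sort size_map -cardE.
apply/idP/idP => [le_c|]; last first.
  by move=> jc; apply: nth_count_le => //; rewrite prednK.
rewrite leqNgt; apply/negP => cj.
suff : c < nth 0 (sort <=%R s) j.-1 by rewrite ltNge le_c.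
by apply: nth_count_gt => //; rewrite sz -ltnS prednK // cj.
Qed.

(** * Measurability of the events *)

Lemma measurable_forall_fin (d : measure_display) (T : measurableType d)
    (F : finType) (b : F -> T -> bool) :
  (forall a, measurable [set x | b a x]) ->
  measurable [set x | [forall a, b a x]].
Proof.
move=> mb.
rewrite (_ : [set _ | _] = \bigcap_(a in [set: F]) [set x | b a x]).
  by apply: fin_bigcap_measurable => //; exact: finite_finset.
by apply/seteqP; split=> x /= => [/forallP bx a _|bx];
  [exact: bx | apply/forallP => a; exact: bx].
Qed.

Lemma measurable_exists_fin (d : measure_display) (T : measurableType d)
    (F : finType) (b : F -> T -> bool) :
  (forall a, measurable [set x | b a x]) ->
  measurable [set x | [exists a, b a x]].
Proof.
move=> mb.
rewrite (_ : [set _ | _] = \bigcup_(a in [set: F]) [set x | b a x]).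
  by apply: fin_bigcup_measurable => //; exact: finite_finset.
by apply/seteqP; split=> x /= => [/existsP[a ba]|[a _ ba]];
  [exists a | apply/existsP; exists a].
Qed.

Lemma measurable_implyb (d : measure_display) (T : measurableType d)
    (b1 b2 : T -> bool) :
  measurable [set x | b1 x] -> measurable [set x | b2 x] ->
  measurable [set x | b1 x ==> b2 x].
Proof.
move=> m1 m2; rewrite (_ : [set _ | _] = ~` [set x | b1 x] `|` [set x | b2 x]).
  by apply: measurableU => //; exact: measurableC.
apply/seteqP; split=> x /=; first by case: (b1 x) => //=; [right | left].
by case: (b1 x) => //= -[/(_ isT)|].
Qed.

Lemma measurable_andb (d : measure_display) (T : measurableType d)
    (b1 b2 : T -> bool) :
  measurable [set x | b1 x] -> measurable [set x | b2 x] ->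
  measurable [set x | b1 x && b2 x].
Proof.
move=> m1 m2; rewrite (_ : [set _ | _] = [set x | b1 x] `&` [set x | b2 x]).
  exact: measurableI.
by apply/seteqP; split=> x /= => [/andP[]|[-> ->]].
Qed.

Lemma measurable_orb (d : measure_display) (T : measurableType d)
    (b1 b2 : T -> bool) :
  measurable [set x | b1 x] -> measurable [set x | b2 x] ->
  measurable [set x | b1 x || b2 x].
Proof.
move=> m1 m2; rewrite (_ : [set _ | _] = [set x | b1 x] `|` [set x | b2 x]).
  exact: measurableU.
by apply/seteqP; split=> x /= => [/orP|bx]; [|apply/orP].
Qed.

Lemma measurable_const_bool (d : measure_display) (T : measurableType d)
    (c : bool) :
  measurable [set x : T | c].
Proof.
case: c.
  rewrite (_ : [set _ | _] = setT); first exact: measurableT.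
  by apply/seteqP; split.
rewrite (_ : [set _ | _] = set0); first exact: measurable0.
by apply/seteqP; split.
Qed.

(** At least [m] of finitely many events occur when all the events of some
    [m]-element index set occur, and there are finitely many such sets. *)
Lemma measurable_card_ge (d : measure_display) (T : measurableType d)
    (F : finType) (m : nat) (b : F -> T -> bool) :
  (forall a, measurable [set x | b a x]) ->
  measurable [set x | (m <= #|finset (fun a => b a x)|)%N].
Proof.
move=> mb.
rewrite (_ : [set _ | _] = [set x | [exists J : {set F}, (m <= #|J|)%N &&
    [forall a, (a \in J) ==> b a x]]]).
  apply: measurable_exists_fin => J; apply: measurable_andb.
    exact: measurable_const_bool.
  apply: measurable_forall_fin => a; apply: measurable_implyb => //.
  exact: measurable_const_bool.
apply/seteqP; split=> x /=.
  move=> mx; apply/existsP; exists (finset (fun a => b a x)); rewrite mx /=.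
  by apply/forallP => a; rewrite inE implybb.
case/existsP=> J /andP[mJ /forallP Jb]; apply: leq_trans mJ (subset_leq_card _).
by apply/fintype.subsetP => a aJ; rewrite inE; move: (Jb a); rewrite aJ.
Qed.

Lemma measurable_mfun_le (d : measure_display) (T : measurableType d)
    (R : realType) (f g : {mfun T >-> R}) :
  measurable [set x | f x <= g x].
Proof. by rewrite -[X in measurable X]setTI; exact: measurable_fun_le. Qed.

Lemma measurable_ordered_pvalue_le (d : measure_display) (T : measurableType d)
    (R : realType) (n : nat) (p : 'I_n -> {mfun T >-> R}) (I : {set 'I_n})
    (j : nat) (g : {mfun T >-> R}) :
  (0 < j <= #|I|)%N ->
  measurable [set x | ordered_pvalue p I j x <= g x].
Proof.
move=> hj; under eq_fun do rewrite (ordered_pvalue_leE _ _ _ hj).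
apply: measurable_card_ge => l; apply: measurable_andb.
  exact: measurable_const_bool.
exact: measurable_mfun_le.
Qed.

Lemma measurable_local_test (d : measure_display) (T : measurableType d)
    (R : realType) (n : nat) (p : 'I_n -> {mfun T >-> R}) (k : nat)
    (I : {set 'I_n}) (c : nat -> R) :
  (0 < k)%N -> measurable [set x | local_test p k I c x].
Proof.
move=> k0; apply: measurable_exists_fin => j.
have [kj /=|_ /=] := leqP k j; last exact: (measurable_const_bool _ false).
apply: (measurable_ordered_pvalue_le _ (cst (c j) : {mfun T >-> R})).
by rewrite (leq_trans k0 kj) -ltnS ltn_ord.
Qed.

Lemma measurable_closed_testing (d : measure_display) (T : measurableType d)
    (R : realType) (n : nat) (p : 'I_n -> {mfun T >-> R}) (k : nat)
    (crit : {set 'I_n} -> nat -> R) (ord : T -> 'S_n) (i : 'I_n) :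
  (0 < k)%N -> pvalue_ordering p ord ->
  measurable [set x | i \in closed_testing p k crit ord x].
Proof.
move=> k0 [mord _]; under eq_fun do rewrite inE.
apply: measurable_orb.
  apply: measurable_exists_fin => j; apply: measurable_andb.
    exact: measurable_const_bool.
  rewrite (_ : [set _ | _] = [set x | [exists s : 'S_n,
      (s j == i) && (ord x == s)]]).
    apply: measurable_exists_fin => s; apply: measurable_andb.
      exact: measurable_const_bool.
    rewrite (_ : [set _ | _] = ord @^-1` [set s]) //.
    by apply/seteqP; split=> x /= /eqP.
  apply/seteqP; split=> x /=.
    by move=> ji; apply/existsP; exists (ord x); rewrite ji eqxx.
  by case/existsP=> s /andP[si /eqP ->].
apply: measurable_forall_fin => I; apply: measurable_implyb; last first.
  exact: measurable_local_test.
have [kI /=|_ /=] := leqP k #|I|; last exact: (measurable_const_bool _ false).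
apply: measurable_andb; first exact: measurable_const_bool.
by apply: measurable_ordered_pvalue_le; rewrite k0.
Qed.

Lemma measurable_num_false_rejections_ge (d : measure_display)
    (T : measurableType d) (R : realType) (n : nat)
    (H : 'I_n -> set (probability T R)) (P : probability T R) (k : nat)
    (rej : T -> {set 'I_n}) :
  (forall i, measurable [set x | i \in rej x]) ->
  measurable [set x | (k <= num_false_rejections H P rej x)%N].
Proof.
move=> mrej.
(* The intersection of two sets of indices is by definition such a [finset]. *)
apply: (@measurable_card_ge _ _ _ k
  (fun i x => (i \in true_nulls H P) && (i \in rej x))) => i.
apply: measurable_andb => //; exact: measurable_const_bool.
Qed.

(** * The combinatorial core *)

(** The witness [a] is the last position occupied by [S]: the members of [S]
    have distinct positions, all of them at most [a], so at least [k] positions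
    are at most [a]. *)
Lemma exists_last_position (n : nat) (s : 'S_n) (S : {set 'I_n}) (k : nat) :
  (0 < k <= #|S|)%N ->
  exists2 a : 'I_n, s a \in S & (k.-1 <= a)%N /\
    (forall l, l \in S -> exists2 b : 'I_n, s b = l & (b <= a)%N).
Proof.
case/andP=> k0 kS.
have [l0 l0S] : exists l, l \in S.
  by apply/set0Pn; rewrite -card_gt0; exact: leq_trans kS.
pose pos l : 'I_n := (s^-1)%g l.
case: (@arg_maxnP _ l0 (mem S) (fun l => pos l : nat) l0S) => i iS imax.
have below l : l \in S -> (pos l <= pos i)%N by move=> lS; exact: imax.
exists (pos i); first by rewrite permKV.
split; last by move=> l lS; exists (pos l); [exact: permKV | exact: below].
rewrite -ltnS prednK //; apply: leq_trans kS _.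
have fS l : l \in S -> (pos l < (pos i).+1)%N by rewrite ltnS; exact: below.
rewrite -[X in (_ <= X)%N]card_ord.
pose f l : 'I_(pos i).+1 := inord (pos l).
rewrite -(card_in_imset (f := f)); first exact: max_card.
move=> a b aS bS /(congr1 val); rewrite /f /= !inordK ?fS // => /val_inj.
exact: perm_inj.
Qed.

(** The least significant of [k] rejected members of [I] is past the
    automatic rejections and has a p-value at least [P_{k:I}], so the local
    test of [H_I] is among those its rejection calls for. *)
Lemma false_rejections_local_test (d : measure_display) (T : measurableType d)
    (R : realType) (n : nat) (p : 'I_n -> {mfun T >-> R}) (k : nat)
    (crit : {set 'I_n} -> nat -> R) (ord : T -> 'S_n) (I : {set 'I_n}) (x : T) :
  (0 < k)%N -> pvalue_ordering p ord ->
  (k <= #|I :&: closed_testing p k crit ord x|)%N ->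
  local_test p k I (crit I) x.
Proof.
move=> k0 [_ pord] kV.
have kI : (k <= #|I|)%N.
  by apply: leq_trans kV (subset_leq_card _); exact: subsetIl.
have kS : (0 < k <= #|I :&: closed_testing p k crit ord x|)%N by rewrite k0.
have [a aS [ka last_a]] := exists_last_position (ord x) kS.
move: aS; rewrite !inE => /andP[aI /orP[|]].
  case/existsP=> j /andP[jk /eqP /perm_inj ja].
  by move: jk; rewrite ja ltnNge ka.
move=> /forallP rejI; move: (rejI I); rewrite kI aI /= => /implyP; apply.
rewrite ordered_pvalue_leE ?k0 //; apply: leq_trans kV (subset_leq_card _).
apply/fintype.subsetP => l lS; have [b bl ba] := last_a l lS.
by rewrite inE (fintype.subsetP (subsetIl _ _) _ lS) -bl pord.
Qed.

Theorem theorem3p1 (R : realType) (d : measure_display) (T : measurableType d)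
    (n k : nat) (hk : (1 <= k <= n)%N) (alpha : R) (halpha : 0 < alpha < 1)
    (Omega : set (probability T R)) (H : 'I_n -> set (probability T R))
    (hH : forall i, H i `<=` Omega)
    (hfree : free_combination Omega H)
    (p : 'I_n -> {mfun T >-> R}) (hp : valid_pvalues H p)
    (ord : T -> 'S_n) (hord : pvalue_ordering p ord)
    (crit : {set 'I_n} -> nat -> R)
    (hcrit : forall (I : {set 'I_n}) (j1 j2 : nat), (k <= #|I|)%N ->
       (k <= j1)%N -> (j1 <= j2)%N -> (j2 <= #|I|)%N ->
       crit I j1 <= crit I j2)
    (hlevel : forall I : {set 'I_n}, (k <= #|I|)%N ->
       level_local_test Omega H p k alpha I (crit I)) :
  controls_kFWER Omega H k alpha (closed_testing p k crit ord).
Proof.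
have k0 : (0 < k)%N by case/andP: hk.
move=> P OP; rewrite /kFWER.
set I := true_nulls H P.
have mV : measurable [set x | (k <=
    num_false_rejections H P (closed_testing p k crit ord) x)%N].
  apply: measurable_num_false_rejections_ge => i.
  exact: measurable_closed_testing hord.
have Vsub : [set x | (k <=
      num_false_rejections H P (closed_testing p k crit ord) x)%N] `<=`
    [set x | local_test p k I (crit I) x].
  by move=> x /=; exact: false_rejections_local_test.
have [kI|Ik] := leqP k #|I|.
  apply: le_trans (hlevel I kI P OP _).
    by apply: le_measure; rewrite ?inE //; exact: measurable_local_test.
  by move=> i /=; rewrite inE => /asboolP.
rewrite (_ : [set _ | _] = set0).
  by rewrite measure0 lee_fin; case/andP: halpha => /ltW.
apply/seteqP; split=> x //= kV.
suff : (k < k)%N by rewrite ltnn.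
apply: leq_ltn_trans kV (leq_ltn_trans _ Ik).
by apply: subset_leq_card; exact: subsetIl.
Qed.
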